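(* Let $\mathcal I$ be an interval system on $[1,n]$. 1. If $\mathcal I$ is an even interval system, then for all positive integers $N$ the poset $P(n,\mathcal I,N)$ is half-Eulerian. 2. If for some $N>1$ the poset $P(n,\mathcal I,N)$ is half-Eulerian, then $\mathcal I$ is an even interval system.
   Context: A graded poset is a finite partially ordered set $P$ with a unique minimum $\hat 0$, a unique maximum $\hat 1$, and a rank function $\rho:P\to\mathbf{N}$ with $\rho(\hat 0)=0$ and $\rho(y)-\rho(x)=1$ whenever $y$ covers $x$; its rank is $\rho(\hat 1)$. $P$ is Eulerian if $\mu([x,y])=(-1)^{\rho(y)-\rho(x)}$ for every interval $[x,y]$ of $P$, where $\mu$ is the Möbius function. The horizontal double $DP$ of $P$ is obtained from $P$ by replacing every $x\in P\setminus\{\hat0,\hat1\}$ with two elements $x_1,x_2$, keeping $\hat0,\hat1$ as minimum and maximum, with $x_i<y_j$ iff $x<y$ in $P$. $P$ is half-Eulerian if $DP$ is Eulerian. For $P$ of rank $n+1$, an interval $I\subseteq[1,n]=\{1,\dots,n\}$ and a positive integer $N$, $D_I^N(P)$ is obtained from $P$ by replacing every $x\in P$ with $\rho(x)\in I$ by $N$ elements $x_1,\dots,x_N$, with: (i) if $\rho(x)\in I$, $\rho(y)\notin I$, then $x_i<y$ iff $x<y$ in $P$, and $y<x_i$ iff $y<x$ in $P$; (ii) if $\rho(x),\rho(y)\in I$, then $x_i<y_j$ iff $i=j$ and $x<y$ in $P$; other relations unchanged. An interval system on $[1,n]$ is a set of (nonempty) subintervals of $[1,n]$, none contained in another; it is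 even if $|I\cap J|$ is even for all $I,J\in\mathcal I$ (including $I=J$). $P(n,\mathcal I,N)$ is obtained from a chain of rank $n+1$ by applying $D_I^N$ for all $I\in\mathcal I$ (the order of application does not matter). *)

(* Defs.v *)
From HB Require Import structures.
From mathcomp Require Import all_boot all_order all_algebra.

Set Implicit Arguments.
Unset Strict Implicit.
Unset Printing Implicit Defensive.

Import Order.TTheory GRing.Theory.

Local Open Scope order_scope.

Definition covers d (P : finPOrderType d) (y x : P) : bool :=
  (x < y) && [forall z, ~~ (x < z < y)].

Definition is_rank d (P : finTBPOrderType d) (rho : P -> nat) : Prop :=
  rho \bot = 0%N /\ forall x y : P, covers y x -> rho y = (rho x).+1.

Record gradedPoset := GradedPoset {
  gp_disp : Order.disp_t;
  gp_sort :> finTBPOrderType gp_disp;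
  rho : gp_sort -> nat;
  rhoP : is_rank rho
}.
Arguments rho {_}.

Definition rank (P : gradedPoset) : nat := rho (\top : P).

(* Structural recursion on the bound k; any k >= #|[x, y]| gives the same      *)
(* value, see mobius_sum for the usual defining equations.                     *)
Fixpoint mobius_rec d (P : finPOrderType d) (k : nat) (x y : P) : int :=
  if k is k'.+1 then
    if x == y then 1%R
    else (- \sum_(z : P | (x <= z < y)%O) mobius_rec k' x z)%R
  else 0%R.

Definition mobius d (P : finPOrderType d) (x y : P) : int :=
  mobius_rec #|P| x y.

Definition eulerian (P : gradedPoset) : Prop :=
  forall x y : P, x <= y -> mobius x y = ((-1) ^+ (rho y - rho x))%R.

Section Mobius.
Context d (P : finPOrderType d).
Implicit Types x y z : P.

Lemma mobius_rec_stable k l x y :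
  (#|[set z | (x <= z <= y)%O]| <= k)%N -> (#|[set z | (x <= z <= y)%O]| <= l)%N ->
  x <= y -> mobius_rec k x y = mobius_rec l x y.
Proof.
elim: k l y => [|k IHk] [|l] y //= hk hl le_xy.
- by move: hk; rewrite leqn0 cards_eq0 => /eqP/setP/(_ x); rewrite !inE lexx le_xy.
- by move: hl; rewrite leqn0 cards_eq0 => /eqP/setP/(_ x); rewrite !inE lexx le_xy.
case: eqP => // _; congr (- _)%R; apply: eq_bigr => z /andP[le_xz lt_zy].
have lt_card : (#|[set t | (x <= t <= z)%O]| < #|[set t | (x <= t <= y)%O]|)%N.
  apply: proper_card; apply/properP; split.
    apply/subsetP => t; rewrite !inE => /andP[-> le_tz] /=.
    exact: le_trans le_tz (ltW lt_zy).
  by exists y; rewrite !inE ?lexx ?le_xy ?(lt_geF lt_zy) ?andbF.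
by apply: IHk => //; rewrite -ltnS; apply: leq_trans lt_card _.
Qed.

Lemma mobiusxx x : mobius x x = 1%R.
Proof.
rewrite /mobius; case E: #|P| => [|k] /=; last by rewrite eqxx.
by have := fintype0 x E.
Qed.

Lemma mobius_sum x y :
  x < y -> (\sum_(z : P | (x <= z <= y)%O) mobius x z = 0)%R.
Proof.
move=> lt_xy; rewrite (bigD1 y) /=; last by rewrite lexx (ltW lt_xy).
rewrite {1}/mobius; case E: #|P| => [|k] /=; first by have := fintype0 x E.
rewrite (lt_eqF lt_xy) addrC; apply/eqP; rewrite subr_eq0; apply/eqP.
have eqP' z : (x <= z <= y) && (z != y) = (x <= z) && (z < y).
  by rewrite -andbA; congr (_ && _); rewrite lt_neqAle andbC.
rewrite (eq_bigl _ _ eqP'); apply: eq_bigr => z /andP[le_xz lt_zy].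
apply: mobius_rec_stable => //; first exact: max_card.
rewrite -ltnS -E; apply: proper_card; apply/properP; split.
  exact/subsetP.
by exists y; rewrite // !inE (lt_geF lt_zy) andbF.
Qed.

End Mobius.

Lemma rho_lt (P : gradedPoset) (x y : P) : x < y -> (rho x < rho y)%N.
Proof.
have [m] := ubnP #|[set z : P | x < z < y]|.
elim: m x y => // m IHm x y; rewrite ltnS => le_m lt_xy.
have [/existsP[z /andP[lt_xz lt_zy]]|no_z] := boolP [exists z, x < z < y].
  have Hz : z \in [set t : P | x < t < y] by rewrite inE lt_xz lt_zy.
  apply: (@ltn_trans (rho z)); apply: IHm => //.
    apply: leq_trans le_m; apply: proper_card; apply/properP; split.
      apply/subsetP => t; rewrite !inE => /andP[-> lt_tz] /=.
      exact: lt_trans lt_tz lt_zy.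
    by exists z; rewrite // inE ltxx andbF.
  apply: leq_trans le_m; apply: proper_card; apply/properP; split.
    apply/subsetP => t; rewrite !inE => /andP[lt_zt ->].
    by rewrite (lt_trans lt_xz lt_zt).
  by exists z; rewrite // inE ltxx.
have -> // : rho y = (rho x).+1.
by apply: (rhoP P).2; rewrite /covers lt_xy -negb_exists.
Qed.

(* Replacing each x satisfying A by N copies: a pair (x, i) with i < N if A x, *)
(* and with i = 0 otherwise.                                                   *)
Section Copies.
Context (T : finType) (A : pred T) (N : nat).

Definition mult (x : T) : nat := if A x then N else 1.

Definition copies : finType := {x : T & 'I_(mult x)}.

Definition base (u : copies) : T := tag u.
Definition idx (u : copies) : nat := tagged u.

Lemma copies_inj (u v : copies) : base u = base v -> idx u = idx v -> u = v.
Proof.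
case: u v => [x i] [y j]; rewrite /base /idx /= => e; case: y / e j => j e.
by congr (existT _ x _); apply: val_inj.
Qed.

Lemma idx0 (u : copies) : ~~ A (base u) -> idx u = 0%N.
Proof.
case: u => x i; rewrite /base /idx /= => nAx.
by have := ltn_ord i; rewrite {2}/mult (negbTE nAx); case: (nat_of_ord i).
Qed.

Lemma idx_lt (u : copies) : A (base u) -> (idx u < N)%N.
Proof.
case: u => x i; rewrite /base /idx /= => Ax.
by have := ltn_ord i; rewrite {2}/mult Ax.
Qed.

Hypothesis N_gt0 : (0 < N)%N.

Lemma mult_gt0 x : (0 < mult x)%N.
Proof. by rewrite /mult; case: ifP. Qed.

Definition copy0 (x : T) : copies :=
  existT (fun x => 'I_(mult x)) x (Ordinal (mult_gt0 x)).

Lemma copy_ex x i : A x -> (i < N)%N -> exists u, base u = x /\ idx u = i.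
Proof.
move=> Ax lt_iN; have h : (i < mult x)%N by rewrite /mult Ax.
by exists (existT (fun x => 'I_(mult x)) x (Ordinal h)).
Qed.

End Copies.

Section HorizontalDouble.
Context (P : gradedPoset).

Definition proper_elt (x : P) : bool := (x != \bot) && (x != \top).

Definition hd_type : Type := copies proper_elt 2.
HB.instance Definition _ := Finite.on hd_type.

Definition hd_lt (u v : hd_type) : bool := base u < base v.

Fact hd_irr : irreflexive hd_lt.
Proof. by move=> u; rewrite /hd_lt ltxx. Qed.

Fact hd_trans : transitive hd_lt.
Proof. by move=> v u w; apply: lt_trans. Qed.

Fact hd_disp : Order.disp_t. Proof. exact: (Order.Disp tt tt). Qed.

HB.instance Definition _ :=
  Order.Lt_isPOrder.Build hd_disp hd_type hd_irr hd_trans.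

Fact hd_bot (u : hd_type) : (copy0 proper_elt (ltn0Sn 1) \bot : hd_type) <= u.
Proof.
rewrite le_eqVlt; case: (eqVneq (base u) \bot) => [e|ne].
  apply/orP; left; apply/eqP/copies_inj => //; rewrite [RHS]idx0 //.
  by rewrite e /proper_elt eqxx.
by apply/orP; right; change (\bot < base u); rewrite lt0x.
Qed.

Fact hd_top (u : hd_type) : u <= (copy0 proper_elt (ltn0Sn 1) \top : hd_type).
Proof.
rewrite le_eqVlt; case: (eqVneq (base u) \top) => [e|ne].
  apply/orP; left; apply/eqP/copies_inj => //; rewrite [LHS]idx0 //.
  by rewrite e /proper_elt eqxx andbF.
by apply/orP; right; change (base u < \top); rewrite ltx1.
Qed.

HB.instance Definition _ := Order.hasBottom.Build hd_disp hd_type hd_bot.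
HB.instance Definition _ := Order.hasTop.Build hd_disp hd_type hd_top.

Definition hd_rho (u : hd_type) : nat := rho (base u).

Fact hd_rhoP : is_rank hd_rho.
Proof.
split; first exact: (rhoP P).1.
move=> u v /andP[lt_uv /forallP no_w]; apply: (rhoP P).2.
apply/andP; split=> //; apply/forallP => z.
exact: no_w (copy0 proper_elt (ltn0Sn 1) z).
Qed.

Definition horizontal_double : gradedPoset := GradedPoset hd_rhoP.

End HorizontalDouble.

Definition half_eulerian (P : gradedPoset) : Prop :=
  eulerian (horizontal_double P).

(* Nonempty subintervals of [1, n], given by their endpoints.                  *)
Definition subint (n : nat) : finType :=
  {p : 'I_n.+1 * 'I_n.+1 | (0 < p.1 <= p.2)%N}.

Definition in_subint n (I : subint n) (k : nat) : bool :=
  ((val I).1 <= k <= (val I).2)%N.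

Definition points n (I : subint n) : {set 'I_n.+1} :=
  [set k : 'I_n.+1 | in_subint I k].

Section IntervalCopies.
Context (P : gradedPoset) (n : nat).

Definition ic_type (Pn : rank P = n.+1) (I : subint n) (N : nat)
    (N_gt0 : (0 < N)%N) : Type :=
  copies (fun x : P => in_subint I (rho x)) N.

Context (Pn : rank P = n.+1) (I : subint n) (N : nat) (N_gt0 : (0 < N)%N).

Local Notation inI := (fun x : P => in_subint I (rho x)).
Local Notation icT := (ic_type Pn I N_gt0).

HB.instance Definition _ := Finite.on icT.

Definition ic_lt (u v : icT) : bool :=
  (base u < base v) &&
  (in_subint I (rho (base u)) && in_subint I (rho (base v))
     ==> (idx u == idx v)).

Fact ic_irr : irreflexive ic_lt.
Proof. by move=> u; rewrite /ic_lt ltxx. Qed.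

Lemma subint_convex (x y z : P) : x < y -> y < z -> inI x -> inI z -> inI y.
Proof.
move=> /rho_lt xy /rho_lt yz /andP[h1 _] /andP[_ h2].
by rewrite /in_subint (leq_trans h1 (ltnW xy)) (leq_trans (ltnW yz) h2).
Qed.

Fact ic_trans : transitive ic_lt.
Proof.
move=> v u w /andP[uv huv] /andP[vw hvw]; rewrite /ic_lt (lt_trans uv vw) /=.
apply/implyP => /andP[hu hw]; have hv := subint_convex uv vw hu hw.
by move: huv hvw; rewrite hu hv hw /= => /eqP-> /eqP->.
Qed.

Fact ic_disp : Order.disp_t. Proof. exact: (Order.Disp tt tt). Qed.

HB.instance Definition _ :=
  Order.Lt_isPOrder.Build ic_disp icT ic_irr ic_trans.

Lemma inI_bot : inI \bot = false.
Proof.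
rewrite /= (rhoP P).1 /in_subint leqn0.
by case: I => /= p /andP[]; case: (nat_of_ord p.1).
Qed.

Lemma inI_top : inI \top = false.
Proof.
rewrite /= -[rho _]/(rank P) Pn /in_subint.
by apply/negbTE; rewrite negb_and -!ltnNge ltn_ord orbT.
Qed.

Fact ic_bot (u : icT) : (copy0 inI N_gt0 \bot : icT) <= u.
Proof.
rewrite le_eqVlt; case: (eqVneq (base u) \bot) => [e|ne].
  apply/orP; left; apply/eqP/copies_inj => //; rewrite [RHS]idx0 //.
  by rewrite e inI_bot.
apply/orP; right; apply/andP; split; first by rewrite lt0x.
by rewrite [in_subint _ _]inI_bot.
Qed.

Fact ic_top (u : icT) : u <= (copy0 inI N_gt0 \top : icT).
Proof.
rewrite le_eqVlt; case: (eqVneq (base u) \top) => [e|ne].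
  apply/orP; left; apply/eqP/copies_inj => //; rewrite [LHS]idx0 //.
  by rewrite e inI_top.
apply/orP; right; apply/andP; split; first by rewrite ltx1.
by rewrite [X in _ && X]inI_top andbF.
Qed.

HB.instance Definition _ := Order.hasBottom.Build ic_disp icT ic_bot.
HB.instance Definition _ := Order.hasTop.Build ic_disp icT ic_top.

Definition ic_rho (u : icT) : nat := rho (base u).

Fact ic_rhoP : is_rank ic_rho.
Proof.
split; first exact: (rhoP P).1.
move=> u v /andP[/andP[lt_uv huv] /forallP no_w]; apply: (rhoP P).2.
apply/andP; split=> //; apply/forallP => z; apply/negP => /andP[uz zv].
suff [w [ew hw]] : exists w : icT, base w = z /\ (inI z ->
    (inI (base u) -> idx w = idx u) /\ (inI (base v) -> idx w = idx v)).
  have /negP[] := no_w w; apply/andP; split; apply/andP; rewrite ew;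
    split=> //; apply/implyP => /andP[h1 h2].
    by rewrite ((hw h2).1 h1).
  by rewrite ((hw h1).2 h2).
have [zI|zI] := boolP (inI z); last by exists (copy0 inI N_gt0 z).
have [uI|uI] := boolP (inI (base u)).
  have [w [ew iw]] := @copy_ex _ inI N _ _ zI (@idx_lt _ inI _ _ uI); exists w; split=> // _.
  by split=> // vI; rewrite iw; move: huv; rewrite uI vI => /eqP.
have [vI|vI] := boolP (inI (base v)); last by exists (copy0 inI N_gt0 z).
by have [w [ew iw]] := @copy_ex _ inI N _ _ zI (@idx_lt _ inI _ _ vI); exists w.
Qed.

Definition interval_copies : gradedPoset := GradedPoset ic_rhoP.

Lemma rank_interval_copies : rank interval_copies = n.+1.
Proof. exact: Pn. Qed.

End IntervalCopies.

(* The library does not join the bounds of 'I_n.+1 with its partial order.     *)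
HB.instance Definition _ (n : nat) := Order.TBPreorder.on 'I_n.+1.

Section Chain.
Context (n : nat).

Fact chain_rhoP : is_rank (fun k : 'I_n.+2 => k : nat).
Proof.
split=> // x y /andP[lt_xy /forallP no_z]; apply/eqP; rewrite eq_sym eqn_leq.
apply/andP; split; first exact: lt_xy.
rewrite leqNgt; apply/negP => lt_Sxy.
have lt_n : (x.+1 < n.+2)%N by apply: ltn_trans lt_Sxy (ltn_ord y).
by have /negP[] := no_z (Ordinal lt_n); apply/andP; split; [exact: ltnSn|].
Qed.

Definition chain : gradedPoset := GradedPoset chain_rhoP.

Lemma rank_chain : rank chain = n.+1.
Proof. by []. Qed.

End Chain.

Definition interval_copies_rk n N (N_gt0 : (0 < N)%N) (I : subint n)
    (P : {P : gradedPoset | rank P = n.+1}) :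
    {P : gradedPoset | rank P = n.+1} :=
  exist _ (interval_copies (svalP P) I N_gt0)
          (rank_interval_copies (svalP P) I N_gt0).

(* P(n, S, N); another order of application gives an isomorphic poset.         *)
Definition Pposet n (S : {set subint n}) N (N_gt0 : (0 < N)%N) : gradedPoset :=
  sval (foldr (@interval_copies_rk n N N_gt0)
              (exist _ (chain n) (rank_chain n)) (enum S)).

Definition interval_system n (S : {set subint n}) : Prop :=
  forall I J, I \in S -> J \in S -> points I \subset points J -> I = J.

Definition even_system n (S : {set subint n}) : Prop :=
  forall I J, I \in S -> J \in S -> ~~ odd #|points I :&: points J|.

(* Main.v *)
(* In [P(n, S, N)] the number of elements of rank [k] strictly between [x] and
   [y], with [rho x = a < k < b = rho y], is [N] to the number of [I] in [S]
   with [k \in I] and [I] contained in the open interval [(a, b)].  As the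
   chain itself is half-Eulerian, [P(n, S, N)] is half-Eulerian iff for all
   [a < b] the excess [\sum_k (-1)^k (N^c(k) - 1)] vanishes, where [c(k)]
   counts those [I].  Expanding [N = 1 + (N - 1)] factor by factor reduces the
   excess to alternating sums over intersections of intervals; three intervals
   have the same intersection as some two of them, so evenness makes them all
   vanish.  Conversely, a second difference of the excess in [a] and [b]
   isolates the alternating sum over a single intersection. *)

Require Import Defs.
From mathcomp Require Import all_boot all_order all_algebra.
From mathcomp Require Import ring zify.

Set Implicit Arguments.
Unset Strict Implicit.
Unset Printing Implicit Defensive.

Import Order.TTheory GRing.Theory Num.Theory.

Local Open Scope ring_scope.

(** * Eulerian and half-Eulerian conditions as alternating rank sums *)

Lemma sum_closed_interval d (P : finPOrderType d) (V : nmodType) (F : P -> V)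
    (x y : P) : (x < y)%O ->
  \sum_(z | (x <= z <= y)%O) F z = F x + F y + \sum_(z | (x < z < y)%O) F z.
Proof.
move=> lt_xy; rewrite (bigD1 x) ?lexx ?ltW //= (bigD1 y) /=; last first.
  by rewrite lexx (ltW lt_xy) gt_eqF.
rewrite addrA; congr (_ + _); apply: eq_bigl => z.
by rewrite !lt_neqAle (eq_sym x z); do ![case: (_ <= _)%O | case: (_ == _)].
Qed.

(** For fixed [x], the Möbius values and the signs [(-1) ^+ (rho z - rho x)] obey the same
    recursion, vanishing sums over closed intervals, which fixes the value at [y] from those below
    it. *)
Lemma eulerianP (P : gradedPoset) :
  eulerian P <->
  forall x y : P, (x < y)%O ->
    \sum_(z : P | (x <= z <= y)%O) (-1) ^+ rho z = 0 :> int.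
Proof.
have sgn (x z : P) : (x <= z)%O ->
    (-1) ^+ rho z = (-1) ^+ rho x * (-1) ^+ (rho z - rho x) :> int.
  rewrite le_eqVlt => /predU1P[->|/rho_lt lt_xz]; first by rewrite subnn mulr1.
  by rewrite -exprD subnKC // ltnW.
split=> [eulP x y lt_xy | sum0 x y].
  under eq_bigr => z /andP[le_xz _] do rewrite (sgn x z le_xz) -eulP //.
  by rewrite -big_distrr /= mobius_sum // mulr0.
have [m] := ubnP (rho y); elim: m y => // m IHm y; rewrite ltnS => le_ym.
rewrite le_eqVlt => /predU1P[<-|lt_xy]; first by rewrite mobiusxx subnn.
have := mobius_sum lt_xy; have := sum0 x y lt_xy.
under eq_bigr => z /andP[le_xz _] do rewrite (sgn x z le_xz).
rewrite -big_distrr /= => /eqP; rewrite mulf_eq0 signr_eq0 /= => /eqP.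
have yin : (x <= y <= y)%O by rewrite lexx ltW.
rewrite (bigD1 y yin) [X in _ -> X = _ -> _](bigD1 y yin) /=.
rewrite [X in _ + X](eq_bigr (fun z : P => mobius x z)).
  by move=> sgn0 mob0; apply: (addIr _ (etrans mob0 (esym sgn0))).
move=> z /andP[/andP[le_xz le_zy] ne_zy]; rewrite IHm //.
by apply: leq_trans le_ym; apply: rho_lt; rewrite lt_neqAle ne_zy.
Qed.

(* Strictly between two elements of the horizontal double there is no minimum
   or maximum, so that every element counts twice. *)
Lemma half_eulerianP (P : gradedPoset) :
  half_eulerian P <->
  forall x y : P, (x < y)%O ->
    (-1) ^+ rho x + (-1) ^+ rho y
      + 2 * \sum_(z : P | (x < z < y)%O) (-1) ^+ rho z = 0 :> int.
Proof.
have double (u v : horizontal_double P) :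
  \sum_(w | (u < w < v)%O) (-1) ^+ rho w =
  2 * \sum_(z : P | (base u < z < base v)%O) (-1) ^+ rho z :> int.
  rewrite big_distrr /=.
  transitivity (\sum_(z : P | (base u < z < base v)%O)
                 \sum_(i < mult (@proper_elt P) 2 z) (-1) ^+ rho z : int).
    by rewrite sig_big_dep; apply: eq_bigl => w; rewrite andbT.
  apply: eq_bigr => z /andP[uz zv]; rewrite sumr_const card_ord /mult.
  rewrite ifT ?mulr_natl // /proper_elt gt_eqF ?lt_eqF //.
    exact: lt_le_trans zv (lex1 _).
  exact: le_lt_trans (le0x _) uz.
rewrite /half_eulerian eulerianP; split=> H x y lt_xy.
  pose c := copy0 (@proper_elt P) (ltn0Sn 1).
  have := H (c x) (c y) lt_xy.
  by rewrite sum_closed_interval // double.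
by rewrite sum_closed_interval // double; apply: H.
Qed.

(** * Counting elements by rank in the open intervals of [Pposet S N_gt0] *)

Definition split_factor n N (a b : nat) (I : subint n) (k : nat) : nat :=
  if [&& in_subint I k, ~~ in_subint I a & ~~ in_subint I b] then N else 1.

(** An endpoint with rank in [I] forces the index of a copy of [z] when [rho z] is in [I]. If both
    endpoints do, [u < v] makes the two indices agree, so one copy remains. *)
Lemma sum_interval_copies (P : gradedPoset) n (Pn : rank P = n.+1)
    (I : subint n) N (N_gt0 : (0 < N)%N) (R : pzSemiRingType) (F : nat -> R)
    (u v : interval_copies Pn I N_gt0) : (u < v)%O ->
  \sum_(w | (u < w < v)%O) F (rho w) =
  \sum_(z : P | (base u < z < base v)%O)
     F (rho z) *+ split_factor N (rho u) (rho v) I (rho z).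
Proof.
case/andP=> lt_uv huv.
pose ok (w : interval_copies Pn I N_gt0) (x : interval_copies Pn I N_gt0) :=
  in_subint I (rho (base x)) && in_subint I (rho (base w)) ==> (idx w == idx x).
pose inc (z : P) (i : 'I_(mult (fun x : P => in_subint I (rho x)) N z)) :
  interval_copies Pn I N_gt0 := existT _ z i.
transitivity (\sum_(z : P | (base u < z < base v)%O)
   \sum_(i < mult (fun x : P => in_subint I (rho x)) N z
          | ok (inc z i) u && ok (inc z i) v) F (rho z)).
  rewrite sig_big_dep; apply: eq_bigl => -[z i].
  change ((u < existT _ z i < v)%O) with (ic_lt u (inc z i) && ic_lt (inc z i) v).
  rewrite /ic_lt /ok /= (andbC (in_subint I (rho (base v)))) (eq_sym (idx u)).
  by rewrite andbACA.
apply: eq_bigr => z _; rewrite sumr_const; congr (_ *+ _).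
rewrite /split_factor -[rho u]/(rho (base u)) -[rho v]/(rho (base v)).
(* Stated for naturals, so that the bound of the ordinal [i] can be rewritten to [N]. *)
pose q (i : nat) :=
  (in_subint I (rho (base u)) && in_subint I (rho z) ==> (i == idx u)) &&
  (in_subint I (rho (base v)) && in_subint I (rho z) ==> (i == idx v)).
rewrite -[LHS]/#|[pred i : 'I_(mult (fun x : P => in_subint I (rho x)) N z) | q i]|.
have card1 m j (lt_jm : (j < m)%N) : #|[pred i : 'I_m | i == j :> nat]| = 1%N.
  by rewrite -(card1 (Ordinal lt_jm)); apply: eq_card => i; rewrite !inE.
have [zI|zI] := boolP (in_subint I (rho z)); last first.
  rewrite /mult /q (negbTE zI) !andbF /= -[RHS]card_ord.
  by apply: eq_card => i; rewrite !inE.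
have -> : mult (fun x : P => in_subint I (rho x)) N z = N by rewrite /mult zI.
rewrite /q zI !andbT /=.
have [uI|uI] := boolP (in_subint I (rho (base u))); last first.
  have [vI|vI] := boolP (in_subint I (rho (base v))) => /=.
    by apply: card1; apply: (@idx_lt _ (fun x : P => in_subint I (rho x))).
  by rewrite -[RHS]card_ord; apply: eq_card => i; rewrite !inE.
have lt_uN : (idx u < N)%N.
  by apply: (@idx_lt _ (fun x : P => in_subint I (rho x))).
rewrite /= -[RHS](card1 _ _ lt_uN); apply: eq_card => i; rewrite !inE.
have [vI|] := boolP (in_subint I (rho (base v))); last by rewrite andbT.
by move: huv; rewrite uI vI => /eqP->; rewrite andbb.
Qed.

(** [F] is arbitrary so that the induction can absorb into it the factor of each interval, which
    depends on ranks only. *)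
Lemma sum_Pposet n (S : {set subint n}) N (N_gt0 : (0 < N)%N) (F : nat -> int)
    (x y : Pposet S N_gt0) : (x < y)%O ->
  \sum_(z | (x < z < y)%O) F (rho z) =
  \sum_(k < n.+2 | (rho x < k < rho y)%N)
     F k *+ (\prod_(I <- enum S) split_factor N (rho x) (rho y) I k)%N.
Proof.
move: x y; rewrite /Pposet; elim: (enum S) F => [|I s IHs] F /= x y.
  by move=> _; apply: eq_bigr => k _; rewrite big_nil.
case: (foldr _ _ _) IHs x y => P Pn /= IHs x y lt_xy.
apply: etrans (sum_interval_copies F lt_xy) _; case/andP: lt_xy => lt_xy _.
pose split k := split_factor N (rho (base x)) (rho (base y)) I k.
apply: etrans (IHs (fun k => F k *+ split k) _ _ lt_xy) _.
by apply: eq_bigr => k _; rewrite big_cons mulrnA.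
Qed.

Lemma Pposet_ranks n (S : {set subint n}) N (N_gt0 : (0 < N)%N) (a b : nat) :
  (a < b <= n.+1)%N ->
  exists x y : Pposet S N_gt0, [/\ (x < y)%O, rho x = a & rho y = b].
Proof.
move=> /andP[lt_ab le_bn]; rewrite /Pposet; elim: (enum S) => [|I s] /=.
  have lt_an : (a < n.+2)%N by lia.
  by exists (Ordinal lt_an), (Ordinal (le_bn : (b < n.+2)%N)).
case: (foldr _ _ _) => P Pn /= [x [y [lt_xy rx ry]]].
(* Both copies have index 0, so they stay comparable. *)
pose c := copy0 (fun x : P => in_subint I (rho x)) N_gt0.
exists (c x), (c y); split=> //.
by apply/andP; split=> //; apply/implyP.
Qed.

Lemma Pposet_rho_le n (S : {set subint n}) N (N_gt0 : (0 < N)%N)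
    (x : Pposet S N_gt0) : (rho x <= n.+1)%N.
Proof.
have <- : rank (Pposet S N_gt0) = n.+1 by rewrite /Pposet; case: (foldr _ _ _).
by have := lex1 x; rewrite le_eqVlt => /predU1P[->//|/rho_lt/ltnW].
Qed.

(** * Reduction to the excess *)

Lemma alternating_interval_sum (l m : nat) :
  \sum_(l <= k < l + m) (-1) ^+ k = if odd m then (-1) ^+ l else 0 :> int.
Proof.
elim: m => [|m IHm]; first by rewrite addn0 big_geq.
rewrite addnS big_nat_recr ?leq_addr //= IHm exprD -(signr_odd _ m).
by case: (odd m) => /=; ring.
Qed.

Lemma subint_bounds n (I : subint n) :
  (0 < (val I).1 <= (val I).2)%N && ((val I).2 <= n)%N.
Proof. by rewrite (valP I) -ltnS ltn_ord. Qed.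

Definition inside n (a b : nat) (I : subint n) : bool :=
  (a < (val I).1)%N && ((val I).2 < b)%N.

Definition coverage n (s : seq (subint n)) (k : nat) : nat :=
  count (fun I => in_subint I k) s.

(** No restriction to [a < k < b] is made: ranks that [s] does not cover contribute 0. *)
Definition excess n N (s : seq (subint n)) : int :=
  \sum_(k < n.+1) (-1) ^+ k * (N%:R ^+ coverage s k - 1).

(** By convexity, an interval through [k] avoids both [a] and [b] exactly when it lies strictly
    between them. *)
Lemma split_factorE n N (s : seq (subint n)) (a b k : nat) : (a < k < b)%N ->
  (\prod_(I <- s) split_factor N a b I k =
     N ^ coverage [seq I <- s | inside a b I] k)%N.
Proof.
move=> akb; elim: s => [|I s IHs]; first by rewrite big_nil.
rewrite big_cons IHs /= /split_factor.
have -> : [&& in_subint I k, ~~ in_subint I a & ~~ in_subint I b]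
    = in_subint I k && inside a b I.
  by rewrite /in_subint /inside; lia.
case: (inside a b I); last by rewrite andbF mul1n.
by rewrite andbT /=; case: in_subint; rewrite ?mul1n // expnS.
Qed.

Lemma half_eulerian_Pposet n (S : {set subint n}) N (N_gt0 : (0 < N)%N) :
  half_eulerian (Pposet S N_gt0) <->
  forall a b : nat, (a < b <= n.+1)%N ->
    excess N [seq I <- enum S | inside a b I] = 0.
Proof.
have key (x y : Pposet S N_gt0) : (x < y)%O ->
  (-1) ^+ rho x + (-1) ^+ rho y
    + 2 * \sum_(z : Pposet S N_gt0 | (x < z < y)%O) (-1) ^+ rho z =
  2 * excess N [seq I <- enum S | inside (rho x) (rho y) I].
  move=> lt_xy; rewrite (sum_Pposet (fun k => (-1) ^+ k) lt_xy).
  have := rho_lt lt_xy; have := Pposet_rho_le y.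
  move: (rho x) (rho y) => a b le_bn lt_ab.
  set s := [seq I <- _ | _]; pose c k : int := (-1) ^+ k * (N%:R ^+ coverage s k - 1).
  have c0 k : ~~ (a < k < b)%N -> c k = 0.
    move=> kab; rewrite /c /coverage (_ : count _ s = 0%N) ?subrr ?mulr0 //.
    apply/eqP; rewrite -leqn0 leqNgt -has_count; apply/hasPn => I.
    by rewrite mem_filter => /andP[]; rewrite /inside /in_subint; lia.
  have -> : excess N s = \sum_(k < n.+2 | (a < k < b)%N) c k.
    rewrite big_mkcond big_ord_recr /= ifF ?addr0; last by lia.
    by apply: eq_bigr => k _; case: ifP => // /negbT/c0.
  rewrite (eq_bigr (fun k : 'I_n.+2 => (-1) ^+ k + c k)); last first.
    by move=> k akb; rewrite split_factorE // -mulr_natr natrX /c; ring.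
  rewrite big_split mulrDr addrA -[RHS]add0r /=; congr (_ + _).
  (* What is left is the share of the chain: twice this sum cancels the two endpoint signs, whatever
     the parity of [b - a]. *)
  have -> : \sum_(k < n.+2 | (a < k < b)%N) (-1) ^+ k =
      \sum_(a.+1 <= k < a.+1 + (b - a.+1)) (-1) ^+ k :> int.
    rewrite subnKC // big_geq_mkord (big_ord_widen_cond n.+2) 1?ltnW //=.
  rewrite alternating_interval_sum.
  have -> : (-1) ^+ b = (-1) ^+ a * - (-1) ^+ odd (b - a.+1) :> int.
    by rewrite signr_odd -{1}(subnKC lt_ab) exprD exprS; ring.
  by rewrite exprS; case: odd => /=; ring.
rewrite half_eulerianP; split=> [H a b ab | H x y lt_xy].
  have [x [y [lt_xy <- <-]]] := Pposet_ranks S N_gt0 ab.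
  by have /eqP := H x y lt_xy; rewrite key // mulf_eq0 /= => /eqP.
by rewrite key // H ?mulr0 // rho_lt // Pposet_rho_le.
Qed.

(** * Parity and alternating sums over intersections *)

Lemma even_card_alternating_sum n (A : {set 'I_n}) :
  \sum_(k in A) (-1) ^+ k = 0 :> int -> ~~ odd #|A|.
Proof.
have -> : \sum_(k in A) (-1) ^+ k = #|A|%:R - 2 * (\sum_(k in A) odd k)%:R :> int.
  rewrite -sum1_card !natr_sum mulr_sumr -sumrB; apply: eq_bigr => k _.
  by rewrite -signr_odd; case: (odd k).
by move: (\sum_(k in A) _)%N #|A| => p q; lia.
Qed.

(** The truncated length [r.+1 - l] also covers disjoint intervals, as an empty range. *)
Lemma sum_meet n (V : nmodType) (F : nat -> V) (I J : subint n) :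
  let l := maxn (val I).1 (val J).1 in let r := minn (val I).2 (val J).2 in
  \sum_(k in points I :&: points J) F k = \sum_(l <= k < l + (r.+1 - l)) F k.
Proof.
case: I J => [[a b] /= Ip] [[c d] /= Jp].
rewrite big_geq_mkord (big_ord_widen_cond n.+1 _ F).
  by apply: eq_bigl => k; rewrite !inE /in_subint /=; lia.
by have := ltn_ord a; have := ltn_ord b; have := ltn_ord c; lia.
Qed.

Lemma alternating_sum_meet n (I J : subint n) :
  ~~ odd #|points I :&: points J| ->
  \sum_(k in points I :&: points J) (-1) ^+ k = 0 :> int.
Proof.
rewrite -sum1_card (sum_meet (fun=> 1%N)) sum_nat_const_nat addKn muln1.
by rewrite (sum_meet (fun k => (-1) ^+ k)) alternating_interval_sum => /negbTE->.
Qed.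

(** The largest left end and the smallest right end come from at most two of the three intervals. *)
Lemma meet3 n (I J L : subint n) :
  [\/ points I :&: points J :&: points L = points I :&: points J,
      points I :&: points J :&: points L = points I :&: points L |
      points I :&: points J :&: points L = points J :&: points L].
Proof.
case: I J L => [[a b] /= Ip] [[c d] /= Jp] [[e f] /= Lp].
have [ac|ac] := leqP a c; have [ae|ae] := leqP a e; have [ce|ce] := leqP c e;
have [bd|bd] := leqP b d; have [bf|bf] := leqP b f; have [df|df] := leqP d f;
solve [ lia
      | constructor 1; apply/setP => k; rewrite !inE /in_subint /=; lia
      | constructor 2; apply/setP => k; rewrite !inE /in_subint /=; lia
      | constructor 3; apply/setP => k; rewrite !inE /in_subint /=; lia].
Qed.

(** * Even systems have zero excess *)

Lemma even_system_coverage n (S : {set subint n}) N (s : seq (subint n)) :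
  even_system S -> {subset s <= S} -> forall I J, I \in S -> J \in S ->
  \sum_(k in points I :&: points J) (-1) ^+ k * N%:R ^+ coverage s k = 0 :> int.
Proof.
move=> evenS; elim: s => [|L s IHs] sS I J IS JS.
  under eq_bigr do rewrite expr0 mulr1.
  exact: alternating_sum_meet (evenS I J IS JS).
have {}IHs := IHs (fun M Ms => sS M (@mem_behead _ (L :: s) M Ms)).
have LS : L \in S by apply: sS; rewrite mem_head.
pose c k : int := (-1) ^+ k * N%:R ^+ coverage s k.
(* Adding [L] multiplies the weight by [N] on [points L]. The correction is a sum over a triple
   intersection, which [meet3] turns into a pair within reach of the induction hypothesis. *)
transitivity (\sum_(k in points I :&: points J) c k +
  (N%:R - 1) * \sum_(k in points I :&: points J :&: points L) c k).
  rewrite [X in _ = _ + _ * X](eq_bigl _ _ (fun k => in_setI k _ _)).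
  rewrite big_mkcondr mulr_sumr -big_split /=; apply: eq_bigr => k _.
  rewrite /c inE /coverage /=; case: (in_subint L k) => /=; last first.
    by rewrite add0n mulr0 addr0.
  by rewrite add1n exprS; ring.
by rewrite /c; have [->|->|->] := meet3 I J L; rewrite !IHs // mulr0 addr0.
Qed.

Lemma even_system_excess n (S : {set subint n}) N (s : seq (subint n)) :
  even_system S -> {subset s <= S} -> excess N s = 0.
Proof.
move=> evenS; elim: s => [|L s IHs] sS.
  by rewrite /excess big1 // => k _; rewrite subrr mulr0.
have sS' : {subset s <= S} := fun M Ms => sS M (@mem_behead _ (L :: s) M Ms).
have LS : L \in S by apply: sS; rewrite mem_head.
have := even_system_coverage N evenS sS' LS LS; rewrite setIid => sumL.
transitivity (excess N s + (N%:R - 1) *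
  \sum_(k in points L) (-1) ^+ k * N%:R ^+ coverage s k); last first.
  by rewrite IHs // sumL mulr0 addr0.
rewrite big_mkcond mulr_sumr -big_split /=; apply: eq_bigr => k _.
rewrite inE /coverage /=; case: (in_subint L k) => /=; last first.
    by rewrite add0n mulr0 addr0.
by rewrite add1n exprS; ring.
Qed.

(** * Zero excess forces evenness *)

Section Antichain.
Variables (n : nat) (S : {set subint n}).
Hypothesis antiS : interval_system S.

Lemma antichain_le (I J : subint n) : I \in S -> J \in S ->
  ((val J).1 <= (val I).1)%N -> ((val I).2 <= (val J).2)%N -> I = J.
Proof.
move=> IS JS le1 le2; apply: antiS => //; apply/subsetP => k.
by rewrite !inE /in_subint; lia.
Qed.

Lemma antichain_left (I J : subint n) : I \in S -> J \in S ->
  (val I).1 = (val J).1 :> nat -> I = J.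
Proof.
move=> IS JS eqIJ; have [le2|/ltnW le2] := leqP (val I).2 (val J).2.
  by apply: antichain_le; rewrite ?eqIJ.
by apply/esym/antichain_le; rewrite ?eqIJ.
Qed.

Lemma antichain_right (I J : subint n) : I \in S -> J \in S ->
  (val I).2 = (val J).2 :> nat -> I = J.
Proof.
move=> IS JS eqIJ; have [le1|/ltnW le1] := leqP (val J).1 (val I).1.
  by apply: antichain_le; rewrite ?eqIJ.
by apply/esym/antichain_le; rewrite ?eqIJ.
Qed.

Lemma coverage_filter (a b k : nat) :
  coverage [seq I <- enum S | inside a b I] k
    = (\sum_(I in S) (in_subint I k && inside a b I))%N.
Proof.
rewrite /coverage count_filter -sum1_count big_mkcond big_enum /=.
by apply: eq_bigr => I _; case: (_ && _).
Qed.

Variable N : nat.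
Hypothesis N_gt1 : (1 < N)%N.
Hypothesis excess0 : forall a b, (a < b <= n.+1)%N ->
  excess N [seq I <- enum S | inside a b I] = 0.

Let N1_neq0 : N%:R - 1 != 0 :> int.
Proof. by lia. Qed.

(** With [a] and [b] just outside [I], the antichain property leaves [I] as the only interval
    inside, so the excess is [N - 1] times the alternating sum over [I]. *)
Lemma even_points (I : subint n) : I \in S -> ~~ odd #|points I|.
Proof.
move=> IS; apply: even_card_alternating_sum.
have bounds : ((val I).1.-1 < (val I).2.+1 <= n.+1)%N.
  by have := subint_bounds I; lia.
have /eqP := excess0 bounds; rewrite /excess.
rewrite (eq_bigr (fun k : 'I_n.+1 =>
    (N%:R - 1) * (if k \in points I then (-1) ^+ k else 0))).
  by rewrite -mulr_sumr -big_mkcond mulf_eq0 (negbTE N1_neq0) => /eqP.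
move=> k _; rewrite coverage_filter (bigD1 I) // big1 => [|L /andP[LS neLI]].
  rewrite inE (_ : inside _ _ I) ?andbT ?addn0.
    by case: in_subint => /=; ring.
  by rewrite /inside; have := subint_bounds I; lia.
rewrite /inside; case: andP => // -[_ /andP[lt1 lt2]].
by move: neLI; rewrite (antichain_le LS IS) ?eqxx //; lia.
Qed.

(* The second difference of the excess in the two endpoints isolates the
   intervals [I] and [J]; every interval of [S] strictly between them contains
   [points I :&: points J], on which the remaining coverage is thus constant. *)
Lemma even_meet_lt (I J : subint n) : I \in S -> J \in S ->
  ((val I).1 < (val J).1)%N -> ((val I).2 < (val J).2)%N ->
  ~~ odd #|points I :&: points J|.
Proof.
move=> IS JS lt1 lt2; apply: even_card_alternating_sum.
have Ip := subint_bounds I; have Jp := subint_bounds J.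
have [a aE] : exists a, (val I).1 = a :> nat by eexists.
have [b bE] : exists b, (val J).2 = b :> nat by eexists.
have neJI : J != I by apply: contraTneq lt1 => ->; rewrite ltnn.
pose c k := (\sum_(L in S | (L != I) && (L != J))
  (in_subint L k && inside a b L))%N.
have covE a' b' k : (a' = a.-1 \/ a' = a) -> (b' = b.+1 \/ b' = b) ->
    coverage [seq L <- enum S | inside a' b' L] k =
    ((in_subint I k && (a' < a)) + (in_subint J k && (b < b')) + c k)%N.
  move=> a'E b'E.
  (* No other member of [S] starts at [a] or ends at [b], so moving the endpoints by one affects
     only [I] and [J]. *)
  have insE (L : subint n) : L \in S -> L != I -> L != J ->
      inside a' b' L = inside a b L.
    move=> LS neI neJ; rewrite /inside.
    have : (val L).1 != a :> nat.
      by apply: contraNneq neI; rewrite -aE => /antichain_left->.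
    have : (val L).2 != b :> nat.
      by apply: contraNneq neJ; rewrite -bE => /antichain_right->.
    by lia.
  rewrite coverage_filter (bigD1 I) // (bigD1 J) /= ?JS // addnA.
  congr (_ + _ + _)%N.
  - by congr (nat_of_bool (_ && _)); rewrite /inside; lia.
  - by congr (nat_of_bool (_ && _)); rewrite /inside; lia.
  apply: eq_big => [L|L /andP[/andP[LS neI] neJ]]; first by rewrite andbA.
  by rewrite insE.
pose m := (\sum_(L in S | (L != I) && (L != J)) inside a b L)%N.
have cE k : k \in points I :&: points J -> c k = m.
  rewrite !inE => /andP[kI kJ]; apply: eq_bigr => L /andP[LS /andP[neI neJ]].
  case: (boolP (inside a b L)) => [/andP[aL Lb]|_]; last by rewrite andbF.
  rewrite andbT; congr nat_of_bool; apply/andP; split.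
    (* If [L] began after [k] it would lie within [J]; if it ended before [k], within [I]. *)
    rewrite leqNgt; apply: contraNN neJ => lt_kL; apply/eqP.
    by apply: antichain_le => //; move: kI kJ; rewrite /in_subint; lia.
  rewrite leqNgt; apply: contraNN neI => lt_Lk; apply/eqP.
  by apply: antichain_le => //; move: kI kJ; rewrite /in_subint; lia.
pose e a' b' := excess N [seq L <- enum S | inside a' b' L].
have : e a.-1 b.+1 - e a b.+1 - e a.-1 b + e a b = 0.
  by rewrite /e !excess0 ?subrr ?addr0 //; lia.
suff -> : e a.-1 b.+1 - e a b.+1 - e a.-1 b + e a b =
    (N%:R - 1) ^+ 2 * N%:R ^+ m * \sum_(k in points I :&: points J) (-1) ^+ k.
  move/eqP; rewrite !mulf_eq0 (negbTE N1_neq0) expf_eq0 pnatr_eq0 /=.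
  by rewrite (gtn_eqF (ltnW N_gt1)) andbF => /eqP.
rewrite /e /excess -!sumrB -big_split mulr_sumr [RHS]big_mkcond /=.
apply: eq_bigr => k _; rewrite !covE; try by [left | right].
rewrite !ltnn !ltnSn (_ : (a.-1 < a)%N) ?andbT ?andbF; last by lia.
case: ifP => [kIJ|].
  rewrite (cE _ kIJ); move: kIJ; rewrite !inE => /andP[-> ->] /=.
  rewrite !exprD; move: (N%:R : int) => q.
  by move: (q ^+ m) ((-1) ^+ k) => x y; rewrite expr1 expr0; ring.
(* Off the intersection the coverage depends on at most one of the two endpoints, so the four terms
   cancel. *)
rewrite !inE; do 2![case: in_subint] => //= _; rewrite !exprD;
  by move: (N%:R ^+ _) (_ ^+ c k) ((-1) ^+ k) => t x y; ring.
Qed.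

End Antichain.

Theorem proposition2p6 (n : nat) (S : {set subint n}) (hS : interval_system S) :
  (even_system S ->
     forall (N : nat) (N_gt0 : (0 < N)%N), half_eulerian (Pposet S N_gt0)) /\
  ((exists (N : nat) (N_gt0 : (0 < N)%N),
      (1 < N)%N /\ half_eulerian (Pposet S N_gt0)) ->
     even_system S).
Proof.
split=> [evenS N N_gt0 | [N [N_gt0 [N_gt1 /half_eulerian_Pposet excess0]]] I J IS JS].
  apply/half_eulerian_Pposet => a b _; apply: even_system_excess evenS _ => I.
  by rewrite mem_filter mem_enum => /andP[].
have even_lt := even_meet_lt hS N_gt1 excess0.
have [<-|neIJ] := eqVneq I J.
  by rewrite setIid; apply: even_points hS _ N_gt1 excess0 _ IS.
(* In an antichain right ends increase with left ends, so [even_meet_lt] applies to any two distinct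
   members in one of the two orders. *)
have incomp K L : K \in S -> L \in S -> K != L ->
    ((val K).1 < (val L).1)%N -> ((val K).2 < (val L).2)%N.
  move=> KS LS neKL lt1; rewrite ltnNge; apply: contraNN neKL => le2.
  by rewrite (antichain_le hS LS KS) // ltnW.
have [lt1|lt1|eq1] := ltngtP (val I).1 (val J).1.
- exact: even_lt (incomp _ _ IS JS neIJ lt1).
- by rewrite setIC; apply: even_lt => //; apply: incomp => //; rewrite eq_sym.
by case/eqP: neIJ; apply: antichain_left hS _ _ IS JS eq1.
Qed.
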